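(* Let $a_H\in\mathcal{A}$ with $a_{\min}<a_H\le a_{\max}$, and define $\hat a\in\mathbb{R}^n_+$ by $\hat a_i=a_{\min}$ if $a_i<a_H$ and $\hat a_i=a_H$ otherwise. Let $w\ge c^\top x$ be any valid inequality for the convex hull of $\{(w,x)\in\mathbb{R}\times\{0,1\}^n: w\ge f(\hat a^\top x),\ \sum_{i=1}^nx_i\le k\}$. If $f$ is monotone increasing, then $w\ge c^\top x$ is valid for $\mathrm{conv}(\mathcal{P}^m_k)$.
   Context: $f:\mathbb{R}\to\mathbb{R}$ is concave with $f(0)=0$, $k$ is a positive integer, and $a\in\mathbb{R}^n_+$ is a weight vector with $m\ge 2$ distinct values (in particular, possibly more than two). $\mathcal{A}$ is the set of distinct values of the entries of $a$, $a_{\min}=\min\mathcal{A}$ and $a_{\max}=\max\mathcal{A}$. $\mathcal{P}^m_k=\{(w,x)\in\mathbb{R}\times\{0,1\}^n: w\ge f(\sum_{i=1}^na_ix_i),\ \sum_{i=1}^nx_i\le k\}$. *)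

(* Defs.v *)
From mathcomp Require Import all_boot all_order all_algebra.
From mathcomp Require Import all_classical all_reals all_analysis.

Set Implicit Arguments.
Unset Strict Implicit.
Unset Printing Implicit Defensive.

Import Order.TTheory GRing.Theory Num.Theory.
Local Open Scope classical_set_scope.
Local Open Scope ring_scope.

Definition concave_function (R : realType) (f : R -> R) : Prop :=
  convex_function [set: convex_lmodType R^o] (fun x => - f x).

Definition dot (R : realType) (n : nat) (u v : 'rV[R]_n) : R :=
  \sum_(i < n) u 0 i * v 0 i.

Definition weight_values (R : realType) (n : nat) (a : 'rV[R]_n) : seq R :=
  undup [seq a 0 i | i : 'I_n].

(* When n = 0 there is no weight and the next two definitions give 0. *)
Definition weight_min (R : realType) (n : nat) (a : 'rV[R]_n) : R :=
  \big[Num.min/head 0 (weight_values a)]_(v <- weight_values a) v.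

Definition weight_max (R : realType) (n : nat) (a : 'rV[R]_n) : R :=
  \big[Num.max/head 0 (weight_values a)]_(v <- weight_values a) v.

Definition two_valued_weight (R : realType) (n : nat) (a : 'rV[R]_n) (aH : R) :
    'rV[R]_n :=
  \row_(i < n) (if a 0 i < aH then weight_min a else aH).

(* R^o is R regarded as a module over itself, so that pairs (w, x) live in a
   real vector space. *)
Definition card_constrained_epigraph (R : realType) (n : nat) (f : R -> R)
    (k : nat) (a : 'rV[R]_n) : set (R^o * 'rV[R]_n)%type :=
  [set p : R^o * 'rV[R]_n | [/\ forall i, p.2 0 i = 0 \/ p.2 0 i = 1,
               f (dot a p.2) <= p.1 &
               \sum_(i < n) p.2 0 i <= k%:R]].

Definition convex_hull (R : realType) (E : lmodType R) (S : set E) : set E :=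
  smallest (@convex_set R E) S.

(* The inequality w >= c^T x holds at every point (w, x) of S. *)
Definition valid_inequality (R : realType) (n : nat) (c : 'rV[R]_n)
    (S : set (R^o * 'rV[R]_n)%type) : Prop :=
  forall p, S p -> dot c p.2 <= p.1.

(* Main.v *)
(* Lowering the weights to a-hat can only lower f(a^T x) when f is increasing
   and x >= 0, so the epigraph for a is contained in the one for a-hat; and
   {(w, x) : w >= c^T x} is convex, so validity passes to the convex hull. *)
Require Import Defs.
From mathcomp Require Import all_boot all_order all_algebra.
From mathcomp Require Import all_classical all_reals all_analysis.
Import Order.TTheory GRing.Theory Num.Theory.
Local Open Scope classical_set_scope.
Local Open Scope ring_scope.

(** Since [dot c] is linear, the inequality at a convex combination is the sum of the inequalities
    at its two endpoints, scaled by the nonnegative weights [t] and [1 - t]. *)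
Lemma convex_valid_halfspace (R : realType) (n : nat) (c : 'rV[R]_n) :
  @convex_set R (R^o * 'rV[R]_n)%type [set p | dot c p.2 <= p.1].
Proof.
move=> [w x] [v y] t; rewrite !inE /= => cx cy.
have -> : dot c (t%:num *: x + (1 - t%:num) *: y) =
    t%:num * dot c x + (1 - t%:num) * dot c y.
  rewrite /dot !mulr_sumr -big_split /=; apply: eq_bigr => i _.
  by rewrite !mxE mulrDr !(mulrCA (c 0 i)).
have t_ge0 : 0 <= t%:num by exact: ge0.
have t_le1 : 0 <= 1 - t%:num by rewrite subr_ge0; exact: le1.
exact: lerD (ler_wpM2l t_ge0 cx) (ler_wpM2l t_le1 cy).
Qed.

Lemma valid_inequality_convex_hull (R : realType) (n : nat) (c : 'rV[R]_n)
    (S : set (R^o * 'rV[R]_n)%type) :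
  valid_inequality c S -> valid_inequality c (convex_hull S).
Proof.
(* The half-space is a convex superset of [S], so it contains the smallest one. *)
move=> cS p; exact: (smallest_sub (convex_valid_halfspace R n c) cS).
Qed.

Lemma weight_min_le (R : realType) (n : nat) (a : 'rV[R]_n) (i : 'I_n) :
  weight_min a <= a 0 i.
Proof.
by apply: ge_bigmin_seq => //; rewrite mem_undup; apply/mapP; exists i;
  rewrite ?mem_enum.
Qed.

Lemma two_valued_weight_le (R : realType) (n : nat) (a : 'rV[R]_n) (aH : R)
    (i : 'I_n) :
  two_valued_weight a aH 0 i <= a 0 i.
(* In the branch that assigns [aH], the failed test [a 0 i < aH] is itself the bound. *)
Proof. by rewrite mxE; case: ltP => // _; exact: weight_min_le. Qed.

Lemma card_constrained_epigraphS (R : realType) (n k : nat) (f : R -> R)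
    (a b : 'rV[R]_n) :
  {homo f : x y / x <= y} -> (forall i, b 0 i <= a 0 i) ->
  card_constrained_epigraph f k a `<=` card_constrained_epigraph f k b.
Proof.
move=> f_homo b_le_a [w x] /= [x01 fw xk]; split=> //.
apply: le_trans fw; apply: f_homo; apply: ler_sum => i _.
(* Multiplying the weight comparison by [x 0 i] keeps its direction because a binary entry is
   nonnegative. *)
by apply: ler_wpM2r => //; case: (x01 i) => /= ->.
Qed.

Theorem proposition6p1 (R : realType) (f : R -> R) (n k m : nat)
    (a : 'rV[R]_n) (aH : R) (c : 'rV[R]_n)
    (f_concave : concave_function f) (f0 : f 0 = 0) (k_gt0 : (0 < k)%N)
    (a_ge0 : forall i, 0 <= a 0 i)
    (m_ge2 : (2 <= m)%N) (a_values : size (weight_values a) = m)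
    (aH_value : aH \in weight_values a)
    (aH_gtmin : weight_min a < aH) (aH_lemax : aH <= weight_max a)
    (c_valid : valid_inequality c
      (convex_hull (card_constrained_epigraph f k (two_valued_weight a aH))))
    (f_increasing : {homo f : x y / x <= y}) :
  valid_inequality c (convex_hull (card_constrained_epigraph f k a)).
Proof.
apply: valid_inequality_convex_hull => p p_epi; apply: c_valid.
(* A point of the epigraph for the two-valued weights lies in its hull, where [c_valid] applies. *)
apply: sub_gen_smallest.
exact: (card_constrained_epigraphS _ _ _ _ _ _ f_increasing
  (two_valued_weight_le _ _ a aH)).
Qed.
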